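(* Let $d=(d_1,\ldots,d_n)$ be a degree sequence with $d_4\ge 2$, $\sum_i d_i>2n$, and $\mu_{odd}+\mu_1\ge 2$, and let $m=\frac12\sum_i d_i$. There is a bipartite cactus realization of $d$ if and only if $m\le\left\lfloor\frac{4(n-1)-\beta}{3}\right\rfloor$, where $\beta=\max\{\mu_1,\tfrac12(\mu_1+\mu_{odd})\}$.
   Context: A degree sequence is a sequence of integers $d_i\in\{1,\ldots,n-1\}$ with even sum and $d_1\ge\cdots\ge d_n$; a realization is a simple graph on $\{1,\ldots,n\}$ with $\deg(i)=d_i$. A cactus is a connected simple graph in which every edge lies on at most one cycle; a bi-cactus is a bipartite cactus. $\mu_1$ is the number of entries of $d$ equal to $1$, and $\mu_{odd}$ is the number of entries that are odd integers greater than $1$. *)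

(* Defs.v *)
From mathcomp Require Import all_boot.
Set Implicit Arguments. Unset Strict Implicit. Unset Printing Implicit Defensive.

(* Vertices {1,...,n} are represented by 'I_n (vertex i+1 <-> ordinal i). *)

Definition degree_sequence (n : nat) (d : seq nat) : Prop :=
  [/\ size d = n,
      all (fun x => (1 <= x) && (x <= n - 1)) d,
      ~~ odd (sumn d) &
      sorted geq d].

Definition simple_graph (n : nat) (e : rel 'I_n) : Prop :=
  (forall x, ~~ e x x) /\ (forall x y, e x y = e y x).

Definition deg (n : nat) (e : rel 'I_n) (x : 'I_n) : nat := #|[set y | e x y]|.

Definition realizes (n : nat) (e : rel 'I_n) (d : seq nat) : Prop :=
  simple_graph e /\ forall x : 'I_n, deg e x = nth 0 d x.

Definition connected_graph (n : nat) (e : rel 'I_n) : Prop :=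
  forall x y : 'I_n, connect e x y.

Definition is_graph_cycle (n : nat) (e : rel 'I_n) (s : seq 'I_n) : Prop :=
  [/\ 3 <= size s, uniq s & cycle e s].

Definition cycle_edges (n : nat) (s : seq 'I_n) : {set {set 'I_n}} :=
  [set [set x; next s x] | x in s].

Definition cactus (n : nat) (e : rel 'I_n) : Prop :=
  connected_graph e /\
  forall s1 s2 : seq 'I_n, is_graph_cycle e s1 -> is_graph_cycle e s2 ->
    forall E : {set 'I_n}, E \in cycle_edges s1 -> E \in cycle_edges s2 ->
      cycle_edges s1 = cycle_edges s2.

Definition bipartite (n : nat) (e : rel 'I_n) : Prop :=
  exists c : 'I_n -> bool, forall x y, e x y -> c x != c y.

Definition bi_cactus (n : nat) (e : rel 'I_n) : Prop :=
  cactus e /\ bipartite e.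

Definition mu1 (d : seq nat) : nat := count (fun x => x == 1) d.
Definition muodd (d : seq nat) : nat := count (fun x => odd x && (1 < x)) d.

(* beta = max{mu_1, (mu_1 + mu_odd)/2}; mu_1 + mu_odd is the number of odd
   entries, which is even for a degree sequence, so the halving is exact. *)
Definition beta (d : seq nat) : nat := maxn (mu1 d) ((mu1 d + muodd d)./2).

(* Main.v *)
Require Import Defs.
From mathcomp Require Import all_boot zify.
Set Implicit Arguments. Unset Strict Implicit. Unset Printing Implicit Defensive.

(** Necessity. Deleting an edge of a cycle of length at least 4 turns the other
    edges of that cycle into bridges, so [3 m + b] never decreases, where [m]
    counts edges and [b] bridges; it ends at a forest, where [b = m <= n - 1].
    Hence [3 m + b <= 4 (n - 1)]. Every leaf has its own bridge, and since the
    non-bridge edges at a vertex come in pairs, one pair per cycle through it,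
    every odd vertex meets a bridge: [b >= beta].

    Sufficiency. Gluing an edge or an even cycle to a bipartite cactus at a vertex
    gives a bipartite cactus. Backwards: remove a leaf from an odd vertex, or two
    leaves from an even vertex, or, when there is no leaf, a 4-cycle; all three
    moves keep the slack [4 (n - 1) - beta - 3 m], and they end at a single even
    cycle. Only [m] even is possible once all degrees are even; this is automatic
    at slack zero, so a positive slack is first spent on contracting a vertex of
    degree [2] into a leaf next to it. *)

(** * Cycles *)

Lemma eq_set2 (T : finType) (x y u v : T) :
  [set x; y] = [set u; v] -> (x = u /\ y = v) \/ (x = v /\ y = u).
Proof.
move/setP => E; move: (E x) (E y) (E u) (E v); rewrite !inE !eqxx /= ?orbT.
by do 2![move=> /esym/orP[/eqP ?|/eqP ?]]; do 2![move=> /orP[/eqP ?|/eqP ?]];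
  subst; auto.
Qed.

Lemma sum_nat_bool (T : finType) (p : pred T) :
  \sum_x (p x : nat) = #|[set x | p x]|.
Proof.
by rewrite -sum1dep_card [RHS]big_mkcond; apply: eq_bigr => x _; case: (p x).
Qed.

Section Cycles.
Variable T : finType.
Implicit Types (e : rel T) (s : seq T) (x y z : T).

(* [deg], [is_graph_cycle], [cycle_edges] and the second clause of [cactus] are the case
   ['I_n] of the next four notions; gluing needs other vertex types. *)
Definition degree e x : nat := #|[set y | e x y]|.

Definition simple_cycle e s : bool := [&& 3 <= size s, uniq s & cycle e s].

Definition edges_of_cycle s : {set {set T}} := [set [set x; next s x] | x in s].

Definition edge_disjoint_cycles e : Prop :=
  forall s1 s2, simple_cycle e s1 -> simple_cycle e s2 ->
  forall E, E \in edges_of_cycle s1 -> E \in edges_of_cycle s2 ->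
  edges_of_cycle s1 = edges_of_cycle s2.

Lemma degreeE e x : degree e x = \sum_y e x y.
Proof. by rewrite sum_nat_bool. Qed.

Lemma simple_cycle_uniq e s : simple_cycle e s -> uniq s.
Proof. by case/and3P. Qed.

Lemma simple_cycle_size e s : simple_cycle e s -> size s <= #|T|.
Proof. by move/simple_cycle_uniq/card_uniqP <-; apply: max_card. Qed.

Lemma sub_simple_cycle e e' s : subrel e e' -> simple_cycle e s -> simple_cycle e' s.
Proof. by move=> ee' /and3P[s3 us cs]; rewrite /simple_cycle s3 us (sub_cycle ee'). Qed.

Lemma sub_edge_disjoint_cycles e e' :
  subrel e' e -> edge_disjoint_cycles e -> edge_disjoint_cycles e'.
Proof. by move=> e'e de s1 s2 c1 c2; apply: de; apply: sub_simple_cycle e'e _. Qed.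

Lemma mem_edges_of_cycle s x y : uniq s ->
  ([set x; y] \in edges_of_cycle s) =
  (x \in s) && ((y == next s x) || (y == prev s x)).
Proof.
move=> us; apply/imsetP/andP => [[z zs /eq_set2[[-> ->]|[-> ->]]]|].
- by rewrite eqxx.
- by rewrite mem_next prev_next // eqxx orbT.
- case=> xs /orP[/eqP->|/eqP->]; first by exists x.
  by exists (prev s x); rewrite ?mem_prev // next_prev // setUC.
Qed.

Lemma edge_of_cycle_mem s x y :
  uniq s -> [set x; y] \in edges_of_cycle s -> (x \in s) && (y \in s).
Proof.
by move=> us; rewrite mem_edges_of_cycle // => /andP[xs /orP[]/eqP->];
  rewrite ?mem_next ?mem_prev xs.
Qed.

Lemma edge_of_simple_cycle e s x y :
  symmetric e -> simple_cycle e s -> [set x; y] \in edges_of_cycle s -> e x y.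
Proof.
move=> se /and3P[_ us cs]; rewrite mem_edges_of_cycle // => /andP[xs /orP[]/eqP->].
  exact: next_cycle.
by rewrite se; apply: prev_cycle.
Qed.

Lemma next_neq_prev s x : 3 <= size s -> uniq s -> x \in s -> next s x != prev s x.
Proof.
move=> s3 us xs; apply/eqP => nxt_prv.
have : next s (next s x) = x by rewrite nxt_prv next_prev.
have [i p s_rot] := rot_to xs; rewrite -!(next_rot i us) s_rot.
move: us s3; rewrite -(rot_uniq i) -(size_rot i) s_rot.
case: p {s_rot} => [|y [|z p]] //=; rewrite !inE !negb_or.
by rewrite !eqxx eq_sym => /andP[/and3P[/negbTE-> /eqP xz _] _] _ zx; case: xz.
Qed.

Lemma card_cycle_nbrs e s x : simple_cycle e s ->
  #|[set y | [set x; y] \in edges_of_cycle s]| = 2 * (x \in s).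
Proof.
case/and3P => s3 us _; case xs: (x \in s).
  rewrite (_ : [set y | _] = [set next s x; prev s x]).
    by rewrite cards2 next_neq_prev.
  by apply/setP => y; rewrite !inE mem_edges_of_cycle // xs.
by rewrite muln0; apply: eq_card0 => y; rewrite !inE mem_edges_of_cycle // xs.
Qed.

Lemma edges_of_cycle_degree2 e s x y : symmetric e -> simple_cycle e s ->
  x \in s -> degree e x <= 2 -> ([set x; y] \in edges_of_cycle s) = e x y.
Proof.
move=> se cs xs d2.
have /eqP/setP/(_ y) : [set y | [set x; y] \in edges_of_cycle s] == [set y | e x y].
  rewrite eqEcard (card_cycle_nbrs x cs) xs d2 andbT.
  by apply/subsetP => z; rewrite !inE; apply: edge_of_simple_cycle.
by rewrite !inE.
Qed.

Lemma edge_disjoint_max_degree2 e :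
  symmetric e -> (forall x, degree e x <= 2) -> edge_disjoint_cycles e.
Proof.
move=> se d2.
have sub s1 s2 E : simple_cycle e s1 -> simple_cycle e s2 ->
    E \in edges_of_cycle s1 -> E \in edges_of_cycle s2 ->
    edges_of_cycle s1 \subset edges_of_cycle s2.
  move=> c1 c2 /imsetP[x xs1 ->] /(edge_of_cycle_mem (simple_cycle_uniq c2))/andP[xs2 _].
  have closed_s2 : closed e (mem s2).
    apply: (intro_closed (sym_connect_sym se)) => u v euv us2.
    rewrite -(edges_of_cycle_degree2 v se c2 us2 (d2 u)) in euv.
    by have /andP[] := edge_of_cycle_mem (simple_cycle_uniq c2) euv.
  have [_ _ cs1] := and3P c1.
  apply/subsetP => _ /imsetP[y ys1 ->].
  have ys2 : y \in s2.
    by rewrite -(closed_connect closed_s2 (connect_cycle cs1 xs1 ys1)).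
  by rewrite (edges_of_cycle_degree2 _ se c2) // next_cycle.
by move=> s1 s2 c1 c2 E E1 E2; apply/eqP; rewrite eqEsubset !(sub _ _ E).
Qed.

(* A cycle that leaves a side of the cut would have to return to it through [v]
   as well, hence visit [v] twice. *)
Lemma cycle_same_side (K : eqType) (side : T -> K) e v s :
  (forall x y, e x y -> x != v -> y != v -> side x = side y) ->
  uniq s -> cycle e s -> {in [pred x in s | x != v] &, forall x y, side x = side y}.
Proof.
move=> eside us cs.
have [p [e_p vp sp]] : exists p,
    [/\ sorted e p, v \notin p & {in s, forall x, x != v -> x \in p}].
  have [vs|vs] := boolP (v \in s); last first.
    exists s; split=> //; case: (s) cs => //= x p.
    by rewrite rcons_path => /andP[].
  have [i p s_rot] := rot_to vs; exists p.
  move: us cs; rewrite -(rot_uniq i) -(rot_cycle i) s_rot /= rcons_path.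
  move=> /andP[vp _] /andP[/path_sorted vpath _]; split=> // x.
  by rewrite -(mem_rot i) s_rot inE => /predU1P[->|//]; rewrite eqxx.
have same_trans : transitive (relpre side eq_op) by move=> y x z /= /eqP->.
have side_p : sorted (relpre side eq_op) p.
  apply: (@sub_in_sorted _ [pred x | x != v] e) e_p => [x y xv yv exy|].
    exact/eqP/eside.
  by apply/allP => x; apply: contraTneq => ->.
case: p {e_p vp} side_p sp => [_ sp x y /andP[xs xv]|x0 p].
  by have := sp x xs xv.
move/(order_path_min same_trans)/allP => x0p sp.
have side0 x : x \in [pred x in s | x != v] -> side x = side x0.
  by case/andP => xs xv; have := sp x xs xv; rewrite inE => /predU1P[->//|/x0p/eqP].
by move=> x y /side0-> /side0->.
Qed.

End Cycles.

(** * Bridges *)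

Section Bridges.
Variable T : finType.
Implicit Types (e r : rel T) (s : seq T) (x y : T).

Definition cycle_through e x y : {set {set T}} :=
  if [pick s : #|T|.-bseq T | simple_cycle e s && ([set x; y] \in edges_of_cycle s)]
  is Some s then edges_of_cycle s else set0.

Definition on_cycle e x y : bool := [set x; y] \in cycle_through e x y.

Definition bridge e x y : bool := e x y && ~~ on_cycle e x y.

Lemma on_cycleP e x y :
  reflect (exists2 s, simple_cycle e s & [set x; y] \in edges_of_cycle s)
          (on_cycle e x y).
Proof.
rewrite /on_cycle /cycle_through; case: pickP => [s /andP[cs xys]|no_cycle].
  by rewrite xys; apply: ReflectT; exists s.
rewrite inE; apply: ReflectF => -[s cs xys].
by have := no_cycle (Bseq (simple_cycle_size cs)); rewrite /= cs xys.
Qed.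

Lemma cycle_throughE e s x y : edge_disjoint_cycles e -> simple_cycle e s ->
  [set x; y] \in edges_of_cycle s -> cycle_through e x y = edges_of_cycle s.
Proof.
move=> de cs xys.
have : on_cycle e x y by apply/on_cycleP; exists s.
rewrite /on_cycle /cycle_through; case: pickP => [s' /andP[cs' _] xys'|]; last by rewrite inE.
exact: de cs' cs _ xys' xys.
Qed.

Lemma on_cycleC e x y : on_cycle e x y = on_cycle e y x.
Proof. by rewrite /on_cycle /cycle_through [[set x; y]]setUC. Qed.

Lemma on_cycle_adj e : symmetric e -> subrel (on_cycle e) e.
Proof. by move=> se x y /on_cycleP[s cs]; apply: edge_of_simple_cycle. Qed.

Lemma bridge_sym e : symmetric e -> symmetric (bridge e).
Proof. by move=> se x y; rewrite /bridge se on_cycleC. Qed.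

Lemma sub_on_cycle e e' : subrel e e' -> subrel (on_cycle e) (on_cycle e').
Proof.
move=> ee' x y /on_cycleP[s cs xys]; apply/on_cycleP; exists s => //.
exact: sub_simple_cycle ee' cs.
Qed.

Lemma even_on_cycle_nbrs e x : symmetric e -> edge_disjoint_cycles e ->
  ~~ odd #|[set y | on_cycle e x y]|.
Proof.
move=> se de; set N := [set y | _].
rewrite (@card_uniform_partition _ 2 _ _ _ (preim_partitionP (cycle_through e x) N)).
  by rewrite oddM andbF.
move=> _ /imsetP[y + ->]; rewrite inE => /on_cycleP[s cs xys].
have ->: [set z in N | cycle_through e x y == cycle_through e x z] =
    [set z | [set x; z] \in edges_of_cycle s].
  apply/setP => z; rewrite !inE (cycle_throughE de cs xys); apply/andP/idP.
    by case=> xz_on /eqP->.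
  move=> xzs; split; last by rewrite (cycle_throughE de cs xzs).
  by apply/on_cycleP; exists s.
rewrite (card_cycle_nbrs x cs).
by have /andP[->] := edge_of_cycle_mem (simple_cycle_uniq cs) xys.
Qed.

Lemma odd_bridges e x : symmetric e -> edge_disjoint_cycles e ->
  odd #|[set y | bridge e x y]| = odd (degree e x).
Proof.
move=> se de; rewrite /degree -(cardsID [set y | on_cycle e x y] [set y | e x y]) oddD.
have -> : [set y | e x y] :&: [set y | on_cycle e x y] = [set y | on_cycle e x y].
  by apply/setIidPr/subsetP => y; rewrite !inE; apply: on_cycle_adj.
rewrite (negbTE (even_on_cycle_nbrs x se de)); congr (odd #|pred_of_set _|).
by apply/setP => y; rewrite !inE andbC.
Qed.

Definition del_edge r x y : rel T := fun u v => r u v && ([set u; v] != [set x; y]).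

Lemma del_edge_sym r x y : symmetric r -> symmetric (del_edge r x y).
Proof. by move=> sr u v; rewrite /del_edge sr [[set u; v]]setUC. Qed.

Lemma sub_del_edge r x y : subrel (del_edge r x y) r.
Proof. by move=> u v /andP[]. Qed.

Lemma sub_bridge_del_edge e s x y : edge_disjoint_cycles e ->
  simple_cycle e s -> [set x; y] \in edges_of_cycle s ->
  subrel (bridge e) (bridge (del_edge e x y)).
Proof.
move=> de cs xys u v /andP[euv not_on]; apply/andP; split.
  rewrite /del_edge euv; apply: contraNneq not_on => uvE.
  by apply/on_cycleP; exists s; rewrite ?uvE.
by apply: contraNN not_on; apply: sub_on_cycle; apply: sub_del_edge.
Qed.

Lemma cycle_edge_bridge_del_edge e s x y u v : symmetric e -> edge_disjoint_cycles e ->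
  simple_cycle e s -> [set x; y] \in edges_of_cycle s ->
  [set u; v] \in edges_of_cycle s -> [set u; v] != [set x; y] ->
  bridge (del_edge e x y) u v.
Proof.
move=> se de cs xys uvs uv_neq; apply/andP; split.
  by rewrite /del_edge (edge_of_simple_cycle se cs uvs).
apply/on_cycleP => -[s' cs' uvs'].
move: xys; rewrite -(de _ _ (sub_simple_cycle (@sub_del_edge e x y) cs') cs _ uvs' uvs).
move/(edge_of_simple_cycle (del_edge_sym x y se) cs').
by rewrite /del_edge eqxx andbF.
Qed.

End Bridges.

(** * Counting edges and bridges *)

Section Counting.
Variable T : finType.
Implicit Types (e r : rel T) (s p : seq T) (x y z : T) (A : {set T}).

(* Twice the number of edges when [r] is symmetric and irreflexive. *)
Definition num_arcs r : nat := \sum_x \sum_y r x y.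

Lemma num_arcs_degree r : num_arcs r = \sum_x degree r x.
Proof. by apply: eq_bigr => x _; rewrite degreeE. Qed.

Lemma leq_num_arcs r r' : subrel r r' -> num_arcs r <= num_arcs r'.
Proof.
move=> rr'; apply: leq_sum => x _; apply: leq_sum => y _.
by have := rr' x y; case: (r x y) => // ->.
Qed.

Lemma num_arcs_disjoint r1 r2 r : subrel r1 r -> subrel r2 r ->
  (forall x y, r1 x y -> ~~ r2 x y) -> num_arcs r1 + num_arcs r2 <= num_arcs r.
Proof.
move=> sub1 sub2 disj; rewrite -big_split leq_sum // => x _.
rewrite -big_split leq_sum // => y _ /=.
case r1xy: (r1 x y); first by rewrite (sub1 _ _ r1xy) (negbTE (disj _ _ r1xy)).
by case r2xy: (r2 x y); rewrite // (sub2 _ _ r2xy).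
Qed.

Lemma num_arcs_del_edge r x y : symmetric r -> r x y -> x != y ->
  num_arcs r = num_arcs (del_edge r x y) + 2.
Proof.
move=> sr rxy xy.
have single (z w : T) : \sum_u \sum_v ((u == z) && (v == w) : nat) = 1.
  rewrite (bigD1 z) //= (bigD1 w) //= !eqxx !big1 // => [u /negbTE->|v /negbTE->] //.
  by rewrite big1.
rewrite -[2]/(1 + 1) -{1}(single x y) -(single y x) -!big_split /=.
apply: eq_bigr => u _; rewrite -!big_split; apply: eq_bigr => v _ /=.
rewrite /del_edge; have [uvE|uvN] := eqVneq [set u; v] [set x; y].
  case/eq_set2: uvE => -[-> ->]; rewrite ?[r y x]sr rxy !eqxx (negbTE xy) //.
  by rewrite eq_sym (negbTE xy).
have -> : (u == x) && (v == y) = false.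
  by apply: contraNF uvN => /andP[/eqP-> /eqP->].
have -> : (u == y) && (v == x) = false.
  by apply: contraNF uvN => /andP[/eqP-> /eqP->]; rewrite setUC.
by rewrite andbT !addn0.
Qed.

Lemma num_arcs_cycle e s : simple_cycle e s ->
  num_arcs (fun x y => [set x; y] \in edges_of_cycle s) = 2 * size s.
Proof.
move=> cs; rewrite num_arcs_degree (eq_bigr (fun x => 2 * (x \in s))) => [|x _].
  rewrite -big_distrr sum_nat_bool; congr (2 * _).
  by rewrite -(card_uniqP (simple_cycle_uniq cs)) cardsE.
exact: card_cycle_nbrs cs.
Qed.

Lemma num_bridges_del_edge e s x y : irreflexive e -> symmetric e ->
  edge_disjoint_cycles e -> simple_cycle e s -> [set x; y] \in edges_of_cycle s ->
  num_arcs (bridge e) + 2 * size s <= num_arcs (bridge (del_edge e x y)) + 2.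
Proof.
move=> ie se de cs xys.
have xy : x != y.
  by apply: contraTneq (edge_of_simple_cycle se cs xys) => ->; rewrite ie.
rewrite -(num_arcs_cycle cs).
rewrite (@num_arcs_del_edge (fun u v => [set u; v] \in edges_of_cycle s) x y) //; last first.
  by move=> u v; rewrite [[set u; v]]setUC.
rewrite addnA leq_add2r; apply: num_arcs_disjoint.
- exact: sub_bridge_del_edge cs xys.
- by move=> u v /andP[uvs]; apply: cycle_edge_bridge_del_edge cs xys uvs.
- move=> u v /andP[_ not_on]; apply: contraNN not_on => /andP[uvs _].
  by apply/on_cycleP; exists s.
Qed.

Definition acyclic e : Prop := forall s, ~~ simple_cycle e s.

Lemma acyclic_or_cycle e : acyclic e \/ exists s, simple_cycle e s.
Proof.
have [/existsP[s cs]|no_cycle] := boolP [exists s : #|T|.-bseq T, simple_cycle e s].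
  by right; exists s.
left=> s; apply: contraNN no_cycle => cs.
by apply/existsP; exists (Bseq (simple_cycle_size cs)).
Qed.

Lemma simple_cycle_of_chord e x p z : symmetric e -> uniq (x :: p) -> path e x p ->
  z \in p -> z != head x p -> e x z -> exists s, simple_cycle e s.
Proof.
move=> se + + /splitPr zp; case: p / zp => p1 p2 up xp z_head exz.
exists (x :: rcons p1 z); apply/and3P; split.
- by case: p1 z_head {up xp} => [|a [|b p1]] /=; rewrite ?eqxx ?size_rcons.
- by move: up; rewrite -cat_rcons -cat_cons cat_uniq => /andP[].
- rewrite /= rcons_path last_rcons se exz andbT.
  by move: xp; rewrite -cat_rcons cat_path => /andP[].
Qed.

Lemma acyclic_extend_path e A x p : irreflexive e -> symmetric e -> acyclic e ->
  1 < #|[set y in A | e x y]| -> uniq (x :: p) -> path e x p ->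
  exists2 z, z \in A & uniq (z :: x :: p) && path e z (x :: p).
Proof.
move=> ie se ac dx up xp.
have /set0Pn[z] : [set y in A | e x y] :\ head x p != set0.
  by rewrite -card_gt0; move: dx; rewrite (cardsD1 (head x p)); case: (_ \in _) => //; lia.
rewrite !inE => /and3P[z_head zA exz]; exists z; rewrite //= se exz.
have zx : z != x by apply: contraTneq exz => ->; rewrite ie.
have zp : z \notin p.
  apply/negP => zp; have [s] := simple_cycle_of_chord se up xp zp z_head exz.
  exact/negP/ac.
by move: up; rewrite inE (negbTE zx) zp xp andbT => /= ->.
Qed.

Lemma acyclic_low_degree e A : irreflexive e -> symmetric e -> acyclic e -> 0 < #|A| ->
  exists2 x, x \in A & #|[set y in A | e x y]| <= 1.
Proof.
move=> ie se ac; rewrite card_gt0 => /set0Pn[x0 x0A].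
have [/exists_inP //|] := boolP [exists x in A, #|[set y in A | e x y]| <= 1].
rewrite negb_exists_in => /forall_inP dA.
have long k : exists x p, [/\ x \in A, uniq (x :: p), path e x p & size p = k].
  elim: k => [|k [x [p [xA up xp <-]]]]; first by exists x0, [::].
  have [|z zA /andP[uzp zp]] := @acyclic_extend_path e A x p ie se ac _ up xp.
    by rewrite ltnNge dA.
  by exists z, (x :: p).
have [x [p [_ up _ size_p]]] := long #|T|.
by have := max_card (mem (x :: p)); rewrite (card_uniqP up) /= size_p ltnn.
Qed.

Lemma acyclic_arcs_within e A : irreflexive e -> symmetric e -> acyclic e -> 0 < #|A| ->
  \sum_(x in A) \sum_(y in A) e x y + 2 <= 2 * #|A|.
Proof.
move=> ie se ac; have [N] := ubnP #|A|; elim: N A => // N IH A ltN A_gt0.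
have [x xA] := acyclic_low_degree ie se ac A_gt0.
have -> : #|[set y in A | e x y]| = \sum_(y in A) e x y.
  by rewrite -sum1dep_card big_mkcondr; apply: eq_bigr => y _; case: (e x y).
rewrite (big_setD1 _ xA) /= ie add0n => dx.
have -> : \sum_(i in A) \sum_(j in A) e i j =
    2 * \sum_(j in A :\ x) e x j + \sum_(i in A :\ x) \sum_(j in A :\ x) e i j.
  rewrite (big_setD1 _ xA) /= (big_setD1 _ xA) /= ie add0n mulSn mul1n -addnA.
  congr (_ + _); rewrite -big_split; apply: eq_bigr => i _.
  by rewrite (big_setD1 _ xA) /= se.
have cardA : #|A| = #|A :\ x|.+1 by rewrite (cardsD1 x) xA.
have [/eqP|Ax_gt0] := posnP #|A :\ x|.
  by rewrite cards_eq0 => /eqP Ax0; rewrite cardA Ax0 !big_set0 cards0.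
by have := IH (A :\ x); rewrite cardA in ltN *; move=> /(_ _ Ax_gt0); lia.
Qed.

Lemma acyclic_num_arcs e : irreflexive e -> symmetric e -> acyclic e -> 0 < #|T| ->
  num_arcs e + 2 <= 2 * #|T|.
Proof.
move=> ie se ac; rewrite -cardsT => /(acyclic_arcs_within ie se ac).
by rewrite big_set; under eq_bigr do rewrite big_set.
Qed.

Lemma edge_disjoint_girth_bound e g : irreflexive e -> symmetric e ->
  edge_disjoint_cycles e -> (forall s, simple_cycle e s -> g < size s) -> 0 < #|T| ->
  g * num_arcs e + num_arcs (bridge e) + 2 * g.+1 <= 2 * g.+1 * #|T|.
Proof.
move=> + + + + T_gt0; have [N] := ubnP (num_arcs e).
elim: N e => // N IH e ltN ie se de girth.
have [ac|[s cs]] := acyclic_or_cycle e.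
  have : num_arcs (bridge e) <= num_arcs e by apply: leq_num_arcs => x y /andP[].
  have := acyclic_num_arcs ie se ac T_gt0; nia.
have [x [y xys]] : exists x y, [set x; y] \in edges_of_cycle s.
  case: s cs => // x s _; exists x, (next (x :: s) x).
  by apply/imsetP; exists x; rewrite ?mem_head.
have exy := edge_of_simple_cycle se cs xys.
have xy : x != y by apply: contraTneq exy => ->; rewrite ie.
have arcsE := num_arcs_del_edge se exy xy.
have brs := num_bridges_del_edge ie se de cs xys.
have del_e := @sub_del_edge _ e x y.
have : g * num_arcs (del_edge e x y) + num_arcs (bridge (del_edge e x y)) + 2 * g.+1
    <= 2 * g.+1 * #|T|.
  apply: IH => [|u||| s' cs']; first lia.
  - by rewrite /del_edge ie.
  - exact: del_edge_sym.
  - exact: sub_edge_disjoint_cycles del_e de.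
  - exact/girth/(sub_simple_cycle del_e).
by have := girth s cs; rewrite arcsE mulnDr; lia.
Qed.

End Counting.

(** * Bipartite cacti *)

Section BipartiteCactus.
Variable T : finType.
Implicit Types (e : rel T) (c : T -> bool) (x y : T).

Definition connected e : Prop := forall x y, connect e x y.

Definition proper_colouring e c : Prop := forall x y, e x y -> c x != c y.

Definition bipartite_cactus e : Prop :=
  [/\ irreflexive e, symmetric e, connected e, edge_disjoint_cycles e
    & exists c, proper_colouring e c].

Lemma proper_colouring_last e c x p :
  proper_colouring e c -> path e x p -> c (last x p) = odd (size p) (+) c x.
Proof.
move=> col; elim: p x => //= y p IH x /andP[/col xy /IH->].
by case: (c x) (c y) xy => [] []; case: (odd _).
Qed.

Lemma even_simple_cycle e c s : proper_colouring e c -> simple_cycle e s -> ~~ odd (size s).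
Proof.
move=> col /and3P[]; case: s => // x p _ _ /(proper_colouring_last col).
by rewrite last_rcons size_rcons /=; case: (c x); case: (odd _).
Qed.

Lemma odd_vertices_bridges e : symmetric e -> edge_disjoint_cycles e ->
  #|[set x | odd (degree e x)]| <= num_arcs (bridge e).
Proof.
move=> se de; rewrite num_arcs_degree -sum_nat_bool; apply: leq_sum => x _.
by rewrite -odd_bridges // -/(degree _ x); case: degree => //= k; case: (odd k).
Qed.

Lemma leaves_bridges e : symmetric e -> edge_disjoint_cycles e ->
  (forall x y, e x y -> degree e x = 1 -> degree e y != 1) ->
  2 * #|[set x | degree e x == 1]| <= num_arcs (bridge e).
Proof.
move=> se de nonadj; set L := [set x | _].
have leaf_bridge x : x \in L -> 1 <= \sum_(y | y \notin L) bridge e x y.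
  rewrite inE => /eqP dx.
  have : 0 < #|[set y | bridge e x y]| by rewrite odd_gt0 // odd_bridges // dx.
  rewrite -sum_nat_bool (bigID (mem L)) /= big1 // => y.
  rewrite inE => dy; apply/eqP; rewrite eqb0; apply: contraTN dy => /andP[exy _].
  exact: nonadj exy dx.
have card_le : #|L| <= \sum_(x in L) \sum_(y | y \notin L) bridge e x y.
  by rewrite -sum1_card; apply: leq_sum => x /leaf_bridge.
rewrite mul2n -addnn /num_arcs [leqRHS](bigID (mem L)) /=; apply: leq_add.
  apply: leq_trans card_le _; apply: leq_sum => x _.
  by rewrite [leqRHS](bigID (mem L)) leq_addl.
apply: leq_trans card_le _; rewrite exchange_big /=; apply: leq_sum => y _.
rewrite [leqRHS](bigID (mem L)) /=; apply: leq_trans (leq_addr _ _).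
by apply: leq_sum => x _; rewrite bridge_sym.
Qed.

Lemma adjacent_leaves e x y : symmetric e -> connected e ->
  e x y -> degree e x = 1 -> degree e y = 1 -> #|T| <= 2.
Proof.
move=> se con exy /eqP/cards1P[a nbrs_x] /eqP/cards1P[b nbrs_y].
have ay : a = y by apply/esym/set1P; rewrite -nbrs_x inE.
have bx : b = x by apply/esym/set1P; rewrite -nbrs_y inE se.
have xy_closed : closed e (mem [set x; y]).
  apply: (intro_closed (sym_connect_sym se)) => u v euv.
  rewrite !inE => /orP[]/eqP uE; move: euv; rewrite {}uE => euv.
    have : v \in [set a] by rewrite -nbrs_x inE.
    by rewrite ay inE => ->; rewrite orbT.
  have : v \in [set b] by rewrite -nbrs_y inE.
  by rewrite bx inE => ->.
rewrite -cardsT (_ : [set: T] = [set x; y]) ?cards2 ?ltnS ?leq_b1 //.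
by apply/setP => u; rewrite inE -(closed_connect xy_closed (con x u)) !inE eqxx.
Qed.

End BipartiteCactus.

Lemma count_codom (T : finType) (f : T -> nat) (p : pred nat) :
  count p (codom f) = #|[set x | p (f x)]|.
Proof. by rewrite count_map cardsE cardE enumT size_filter. Qed.

Lemma count_odd d : count odd d = mu1 d + muodd d.
Proof. by rewrite /mu1 /muodd; elim: d => //= -[|[|x]] d -> //=; lia. Qed.

(* With [m] the half-sum of [d] and [n] its size, this is [3 m + beta d <= 4 (n - 1)]. *)
Definition cactus_bound (d : seq nat) : bool := 3 * sumn d + 2 * beta d + 8 <= 8 * size d.

Lemma bipartite_cactus_bound (T : finType) (e : rel T) :
  2 < #|T| -> bipartite_cactus e -> cactus_bound (codom (degree e)).
Proof.
move=> T3 [ie se con de [c col]]; set d := codom _.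
have girth s : simple_cycle e s -> 3 < size s.
  move=> cs; have [s3 _ _] := and3P cs; have := even_simple_cycle col cs.
  by move: s3; rewrite leq_eqVlt => /predU1P[<-|].
have bound := edge_disjoint_girth_bound ie se de girth (ltnW (ltnW T3)).
have arcs : num_arcs e = sumn d by rewrite sumnE big_image num_arcs_degree.
have leaves : 2 * mu1 d <= num_arcs (bridge e).
  rewrite /mu1 count_codom; apply: leaves_bridges => // x y exy dx; apply/eqP => dy.
  by have := adjacent_leaves se con exy dx dy; rewrite leqNgt T3.
have odds : mu1 d + muodd d <= num_arcs (bridge e).
  by rewrite -count_odd count_codom odd_vertices_bridges.
by rewrite /cactus_bound /beta size_codom -arcs; lia.
Qed.

(** * Gluing two graphs at a vertex *)

Lemma connect_homo (T U : finType) (e : rel T) (e' : rel U) (f : T -> U) x y :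
  {homo f : u v / e u v >-> e' u v} -> connect e x y -> connect e' (f x) (f y).
Proof.
move=> fe /connectP[p + ->]; elim: p x => //= z p IH x /andP[xz /IH].
by apply: connect_trans; apply/connect1/fe.
Qed.

Section Embedding.
Variables (T U : finType) (f : T -> U) (e : rel T) (e' : rel U).
Hypotheses (f_inj : injective f) (e'f : {mono f : x y / e x y >-> e' x y}).

Lemma simple_cycle_map s : simple_cycle e' (map f s) = simple_cycle e s.
Proof. by rewrite /simple_cycle size_map map_inj_uniq // cycle_map (eq_cycle e'f). Qed.

Lemma edges_of_cycle_map s : uniq s ->
  edges_of_cycle (map f s) = [set f @: (E : {set T}) | E in edges_of_cycle s].
Proof.
have edgeE x : uniq s -> [set f x; next (map f s) (f x)] = f @: [set x; next s x].
  by move=> us; rewrite next_map // imsetU1 imset_set1.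
move=> us; apply/setP => F; apply/imsetP/imsetP.
  by case=> _ /mapP[x xs ->] ->; exists [set x; next s x]; rewrite ?edgeE //; apply: imset_f.
by case=> _ /imsetP[x xs ->] ->; exists (f x); rewrite ?edgeE // map_f.
Qed.

Lemma edge_disjoint_cycles_map s1 s2 E : edge_disjoint_cycles e ->
  simple_cycle e' (map f s1) -> simple_cycle e' (map f s2) ->
  E \in edges_of_cycle (map f s1) -> E \in edges_of_cycle (map f s2) ->
  edges_of_cycle (map f s1) = edges_of_cycle (map f s2).
Proof.
rewrite !simple_cycle_map => de c1 c2; rewrite !edges_of_cycle_map ?(simple_cycle_uniq c1,
  simple_cycle_uniq c2) // => /imsetP[F1 F1s ->] /imsetP[F2 F2s] /(imset_inj f_inj) F12.
by rewrite (de _ _ c1 c2 F1) // F12.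
Qed.

Lemma edge_disjoint_cycles_preim : edge_disjoint_cycles e' -> edge_disjoint_cycles e.
Proof.
move=> de s1 s2 c1 c2 E E1 E2; apply/(imset_inj (imset_inj f_inj)).
rewrite -!edges_of_cycle_map ?(simple_cycle_uniq c1, simple_cycle_uniq c2) //.
apply: (de _ _ _ _ (f @: E)); rewrite ?simple_cycle_map //.
  by rewrite edges_of_cycle_map ?(simple_cycle_uniq c1) // imset_f.
by rewrite edges_of_cycle_map ?(simple_cycle_uniq c2) // imset_f.
Qed.

End Embedding.

Section Wedge.
Variables (T1 T2 : finType) (e1 : rel T1) (e2 : rel T2) (v1 : T1) (v2 : T2).

(* The vertices [v1] and [v2] are identified: [inl v1] stands for both. *)
Definition wedge : rel (T1 + {y in predC1 v2}) := fun a b =>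
  match a, b with
  | inl x, inl y => e1 x y
  | inl x, inr y => (x == v1) && e2 v2 (val y)
  | inr x, inl y => (y == v1) && e2 (val x) v2
  | inr x, inr y => e2 (val x) (val y)
  end.

Definition wedge_inr (y : T2) : T1 + {y in predC1 v2} := oapp inr (inl v1) (insub y).

Lemma wedge_inr_base : wedge_inr v2 = inl v1.
Proof. by rewrite /wedge_inr insubN // inE eqxx. Qed.

Lemma wedge_inr_val (y : {y in predC1 v2}) : wedge_inr (val y) = inr y.
Proof. by rewrite /wedge_inr valK. Qed.

Lemma wedge_inr_neq y : y != v2 -> exists u, wedge_inr y = inr u /\ val u = y.
Proof. by move=> yv; exists (Sub y yv); rewrite -wedge_inr_val SubK. Qed.

Lemma wedge_inr_inj : injective wedge_inr.
Proof.
apply: (can_inj (g := fun a => if a is inr y then val y else v2)) => y.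
by have [->|/wedge_inr_neq[u [-> //]]] := eqVneq y v2; rewrite wedge_inr_base.
Qed.

Lemma wedge_side a b : wedge a b -> a != inl v1 -> b != inl v1 -> is_inl a = is_inl b.
Proof.
by case: a b => [x|x] [y|y] //= /andP[/eqP-> _]; rewrite eqxx.
Qed.

Hypotheses (irr1 : irreflexive e1) (irr2 : irreflexive e2).
Hypotheses (sym1 : symmetric e1) (sym2 : symmetric e2).

Lemma wedge_irr : irreflexive wedge.
Proof. by case=> x /=. Qed.

Lemma wedge_sym : symmetric wedge.
Proof. by case=> [x|x] [y|y] //=; rewrite sym2. Qed.

Lemma wedge_inrE : {mono wedge_inr : x y / e2 x y >-> wedge x y}.
Proof.
move=> x y; have [->|/wedge_inr_neq[u [-> <-]]] := eqVneq x v2;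
  have [->|/wedge_inr_neq[w [-> <-]]] := eqVneq y v2;
  by rewrite ?wedge_inr_base /= ?eqxx ?irr1 ?irr2.
Qed.

Lemma wedge_degree_inl x :
  degree wedge (inl x) = degree e1 x + (x == v1) * degree e2 v2.
Proof.
rewrite !degreeE big_sumType /=; congr (_ + _).
have [_|_] := eqVneq x v1; last by rewrite big1.
rewrite mul1n -(big_sub (predC1 v2) (fun y => e2 v2 y : nat)) [RHS](bigD1 v2) //= irr2.
exact: eq_bigl.
Qed.

Lemma wedge_degree_inr y : y != v2 -> degree wedge (wedge_inr y) = degree e2 y.
Proof.
move=> /wedge_inr_neq[u [-> <-]]; rewrite !degreeE big_sumType [RHS](bigD1 v2) //=.
congr (_ + _); last first.
  by rewrite -(big_sub (predC1 v2) (fun y => e2 (val u) y : nat)); apply: eq_bigl.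
by rewrite (bigD1 v1) //= eqxx big1 ?addn0 // => x /negbTE->.
Qed.

Lemma wedge_connected : connected e1 -> connected e2 -> connected wedge.
Proof.
move=> con1 con2; have from_v1 a : connect wedge (inl v1) a.
  case: a => [x|y]; first by apply: (connect_homo (f := inl)) (con1 v1 x).
  rewrite -wedge_inr_base -wedge_inr_val; apply: connect_homo (con2 v2 (val y)).
  by move=> x z; rewrite wedge_inrE.
move=> a b; apply: connect_trans (from_v1 b).
by rewrite (sym_connect_sym wedge_sym).
Qed.

Lemma wedge_colouring c1 c2 : proper_colouring e1 c1 -> proper_colouring e2 c2 ->
  exists c, proper_colouring wedge c.
Proof.
move=> col1 col2.
exists (fun a => match a with
  | inl x => c1 x
  | inr y => c1 v1 (+) (c2 v2 (+) c2 (val y))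
  end) => -[x|x] [y|y] //=.
- exact: col1.
- by case/andP => /eqP-> /col2; case: (c1 v1); case: (c2 v2); case: (c2 _).
- by case/andP => /eqP-> /col2; case: (c1 v1); case: (c2 v2); case: (c2 _).
- by move/col2; case: (c1 v1); case: (c2 v2); case: (c2 (sval x)); case: (c2 _).
Qed.

Lemma wedge_cycle s : simple_cycle wedge s ->
  (exists t, s = map inl t) \/ (exists t, s = map wedge_inr t).
Proof.
case/and3P => _ us cs; have same_side := cycle_same_side wedge_side us cs.
have [/hasP[[//|u] us_ _]|no_inr] := boolP (has (fun a => ~~ is_inl a) s).
  right; exists (preim_seq wedge_inr s); rewrite map_preim // => a as_.
  have [->|av] := eqVneq a (inl v1); first by rewrite -wedge_inr_base codom_f.
  have := same_side (inr u) a; rewrite !inE us_ as_ av => /(_ isT isT).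
  by case: a {as_ av} => // y _; rewrite -wedge_inr_val codom_f.
left; exists (preim_seq inl s); rewrite map_preim // => -[x|y] as_; first exact: codom_f.
by case/hasP: no_inr; exists (inr y).
Qed.

Lemma wedge_no_common_edge t1 t2 E :
  simple_cycle wedge (map inl t1) -> simple_cycle wedge (map wedge_inr t2) ->
  E \in edges_of_cycle (map inl t1) -> E \notin edges_of_cycle (map wedge_inr t2).
Proof.
move=> c1 c2 E1; apply/negP => E2.
have base a : a \in map inl t1 -> a \in map wedge_inr t2 -> a = inl v1.
  move=> /mapP[x _ ->] /mapP[y _]; have [->|/wedge_inr_neq[u [-> //]]] := eqVneq y v2.
  by rewrite wedge_inr_base.
case/imsetP: (E1) => a _ Ea; move: E1 E2; rewrite {}Ea => E1 E2.
have [a1 b1] := andP (edge_of_cycle_mem (simple_cycle_uniq c1) E1).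
have [a2 b2] := andP (edge_of_cycle_mem (simple_cycle_uniq c2) E2).
have := edge_of_simple_cycle wedge_sym c1 E1.
by rewrite (base _ b1 b2) (base _ a1 a2) wedge_irr.
Qed.

Lemma wedge_edge_disjoint : edge_disjoint_cycles e1 -> edge_disjoint_cycles e2 ->
  edge_disjoint_cycles wedge.
Proof.
move=> de1 de2 s1 s2 c1 c2 E E1 E2.
have wedge_inlE : {mono inl : x y / e1 x y >-> wedge x y} by [].
have [] := (wedge_cycle c1, wedge_cycle c2).
case=> -[t1 s1E] [] [t2 s2E]; move: c1 c2 E1 E2; rewrite {}s1E {}s2E => c1 c2 E1 E2.
- exact: (edge_disjoint_cycles_map inl_inj wedge_inlE de1 c1 c2 E1).
- by have := wedge_no_common_edge c1 c2 E1; rewrite E2.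
- by have := wedge_no_common_edge c2 c1 E2; rewrite E1.
- exact: (edge_disjoint_cycles_map wedge_inr_inj wedge_inrE de2 c1 c2 E1).
Qed.

Lemma perm_enum_wedge r1 r2 :
  perm_eq (v1 :: r1) (enum T1) -> perm_eq (v2 :: r2) (enum T2) ->
  perm_eq (enum {: T1 + {y in predC1 v2}}) (inl v1 :: map inl r1 ++ map wedge_inr r2).
Proof.
move=> enum1 enum2; have u1 : uniq (v1 :: r1) by rewrite (perm_uniq enum1) enum_uniq.
have [v2r2 ur2] : v2 \notin r2 /\ uniq r2.
  by apply/andP; rewrite -cons_uniq (perm_uniq enum2) enum_uniq.
rewrite -cat_cons -map_cons; apply: uniq_perm; first exact: enum_uniq.
  rewrite cat_uniq !map_inj_uniq; [|exact: wedge_inr_inj|exact: inl_inj].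
  rewrite u1 ur2 andbT; apply/hasPn => _ /mapP[y yr2 ->].
  have /wedge_inr_neq[u [-> _]] : y != v2 by apply: contraNneq v2r2 => <-.
  by apply/mapP => -[].
move=> a; rewrite mem_enum mem_cat; apply/esym/orP; case: a => [x|u]; [left|right].
  by rewrite map_f // (perm_mem enum1) mem_enum.
rewrite -wedge_inr_val map_f //; have := perm_mem enum2 (val u).
by rewrite mem_enum !inE (negbTE (valP u)).
Qed.

End Wedge.

Arguments wedge {T1 T2} e1 e2 v1 v2 _ _.

Lemma wedge_bipartite_cactus (T1 T2 : finType) (e1 : rel T1) (e2 : rel T2) v1 v2 :
  bipartite_cactus e1 -> bipartite_cactus e2 -> bipartite_cactus (wedge e1 e2 v1 v2).
Proof.
move=> [irr1 sym1 con1 de1 [c1 col1]] [irr2 sym2 con2 de2 [c2 col2]]; split.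
- exact: wedge_irr.
- exact: wedge_sym.
- exact: wedge_connected.
- exact: wedge_edge_disjoint.
- exact: wedge_colouring col1 col2.
Qed.

(** * Realizable sequences *)

Definition realizable (d : seq nat) : Prop :=
  exists (T : finType) (e : rel T), bipartite_cactus e /\ perm_eq (codom (degree e)) d.

Lemma realizable_perm d d' : perm_eq d d' -> realizable d -> realizable d'.
Proof.
by move=> dd' [T [e [cac ed]]]; exists T, e; split=> //; apply: perm_trans dd'.
Qed.

Lemma perm_map_lift (T T' : eqType) (f : T -> T') (s : seq T) (s' : seq T') :
  perm_eq (map f s) s' -> exists2 t, perm_eq t s & map f t = s'.
Proof.
elim: s' s => [|x s' IH] s fs; first by exists [::] => //; move/perm_size: fs; case: s.
have /mapP[y ys xE] : x \in map f s by rewrite (perm_mem fs) mem_head.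
have ys_rem := perm_to_rem ys.
have [|t ts ft] := IH (rem y s).
  by rewrite -(perm_cons x) {1}xE -map_cons -(permPl (perm_map _ ys_rem)).
by exists (y :: t); rewrite /= ?ft ?xE // (permPr ys_rem) perm_cons.
Qed.

Lemma realizable_glue x d y d' :
  realizable (x :: d) -> realizable (y :: d') -> realizable (x + y :: d ++ d').
Proof.
move=> [T1 [e1 [cac1 /perm_map_lift[[//|v1 r1] enum1 /= [<- <-]]]]].
move=> [T2 [e2 [cac2 /perm_map_lift[[//|v2 r2] enum2 /= [<- <-]]]]].
exists (T1 + {y in predC1 v2})%type, (wedge e1 e2 v1 v2).
split; first exact: wedge_bipartite_cactus.
have [irr1 _ _ _ _] := cac1; have [irr2 sym2 _ _ _] := cac2.
have /andP[v1r1 _] : uniq (v1 :: r1) by rewrite (perm_uniq enum1) enum_uniq.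
have /andP[v2r2 _] : uniq (v2 :: r2) by rewrite (perm_uniq enum2) enum_uniq.
rewrite (permPl (perm_map _ (perm_enum_wedge enum1 enum2))) /= map_cat -!map_comp.
rewrite wedge_degree_inl // eqxx mul1n perm_cons.
apply/permP => p; congr (count p (_ ++ _)); apply/eq_in_map => z zr /=.
  rewrite wedge_degree_inl // (_ : z == v1 = false) ?addn0 //.
  by apply: contraNF v1r1 => /eqP<-.
by rewrite wedge_degree_inr //; apply: contraNneq v2r2 => <-.
Qed.

(* For [n = 2] this is a single edge. *)
Definition cycle_graph (n : nat) : rel 'I_n := fun i j => (j == ordS i) || (i == ordS j).

Lemma val_ordS n (i : 'I_n) : ordS i = (if i.+1 == n then 0 else i.+1) :> nat.
Proof.
case: eqVneq => [i_max|i_max]; first by rewrite /= i_max modnn.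
by rewrite /= modn_small // ltn_neqAle i_max ltn_ord.
Qed.

Lemma eq_ordS n (i j : 'I_n) : (i == ordS j) = (i == (if j.+1 == n then 0 else j.+1) :> nat).
Proof. by rewrite -val_ordS. Qed.

Lemma cycle_graph_sym n : symmetric (@cycle_graph n).
Proof. by move=> i j; rewrite /cycle_graph orbC. Qed.

Lemma cycle_graph_irr n : 1 < n -> irreflexive (@cycle_graph n).
Proof. by move=> n2 i; rewrite /cycle_graph orbb eq_ordS; case: ifP; lia. Qed.

Lemma cycle_graph_degree n (i : 'I_n) : 1 < n -> degree (@cycle_graph n) i = (2 < n).+1.
Proof.
move=> n2; have -> : (2 < n) = (ordS i != ord_pred i).
  rewrite -(can2_eq (@ordSK n) (@ord_predK n)) eq_sym eq_ordS val_ordS.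
  by have := ltn_ord i; case: (eqVneq i.+1 n) => i_max; case: ifP; lia.
rewrite -cards2; congr #|pred_of_set _|; apply/setP => j.
by rewrite !inE -(can2_eq (@ordSK n) (@ord_predK n)) [ordS j == i]eq_sym.
Qed.

Lemma cycle_graph_connected n : connected (@cycle_graph n).
Proof.
case: n => [|n]; first by case.
have from0 k (lt_kn : k < n.+1) : connect (@cycle_graph n.+1) ord0 (Ordinal lt_kn).
  elim: k lt_kn => [|k IH] lt_kn; first by apply/eq_connect0/val_inj.
  apply: connect_trans (IH (ltnW lt_kn)) (connect1 _).
  by rewrite /cycle_graph eq_ordS /= (ltn_eqF lt_kn) eqxx.
move=> [i lt_in] [j lt_jn]; apply: connect_trans (from0 j lt_jn).
by rewrite (sym_connect_sym (@cycle_graph_sym _)) from0.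
Qed.

Lemma cycle_graph_colouring n : ~~ odd n ->
  proper_colouring (@cycle_graph n) (fun i => odd i).
Proof.
move=> n_even i j; rewrite /cycle_graph !eq_ordS.
by have := ltn_ord i; have := ltn_ord j; do 2![case: ifP]; lia.
Qed.

Lemma realizable_cycle n : 0 < n -> ~~ odd n -> realizable (nseq n (2 < n).+1).
Proof.
move=> n_gt0 n_even; have n2 : 1 < n by lia.
exists 'I_n, (@cycle_graph n); split; first split.
- exact: cycle_graph_irr.
- exact: cycle_graph_sym.
- exact: cycle_graph_connected.
- apply: edge_disjoint_max_degree2 (@cycle_graph_sym n) _ => i.
  by rewrite cycle_graph_degree // ltnS leq_b1.
- by eexists; apply: cycle_graph_colouring.
suff /all_pred1P -> : all (pred1 (2 < n).+1) (codom (degree (@cycle_graph n))).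
  by rewrite size_codom card_ord.
by apply/allP => _ /codomP[i ->]; rewrite /= cycle_graph_degree.
Qed.

Lemma realizable_pendant x d : realizable (x :: d) -> realizable (x.+1 :: 1 :: d).
Proof. exact: (@realizable_glue 1 [:: 1] x d (@realizable_cycle 2 isT isT)). Qed.

Lemma realizable_square x d : realizable (x :: d) -> realizable (x.+2 :: nseq 3 2 ++ d).
Proof. exact: (@realizable_glue 2 (nseq 3 2) x d (@realizable_cycle 4 isT isT)). Qed.

(** * Reducing a degree sequence *)

Section Reduction.
Implicit Types (d : seq nat) (x k : nat).

(* When all degrees are even there is no bridge, so the edges are partitioned into
   even cycles: hence the last clause, where [sumn d] is twice the number of edges. *)
Definition cactus_sequence (d : seq nat) : bool :=
  [&& 0 \notin d, ~~ odd (sumn d), 2 * size d <= sumn d, cactus_bound d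
    & (0 < mu1 d + muodd d) || (4 %| sumn d)].

Definition tight_bound (d : seq nat) : bool := 3 * sumn d + 2 * beta d + 8 == 8 * size d.

Lemma perm_mu1 d d' : perm_eq d d' -> mu1 d = mu1 d'.
Proof. by move/permP; apply. Qed.

Lemma perm_muodd d d' : perm_eq d d' -> muodd d = muodd d'.
Proof. by move/permP; apply. Qed.

Lemma perm_beta d d' : perm_eq d d' -> beta d = beta d'.
Proof. by move=> dd'; rewrite /beta (perm_mu1 dd') (perm_muodd dd'). Qed.

Lemma perm_cactus_bound d d' : perm_eq d d' -> cactus_bound d = cactus_bound d'.
Proof.
by move=> dd'; rewrite /cactus_bound (perm_beta dd') (perm_size dd') (perm_sumn dd').
Qed.

Lemma perm_tight_bound d d' : perm_eq d d' -> tight_bound d = tight_bound d'.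
Proof. by move=> dd'; rewrite /tight_bound (perm_beta dd') (perm_size dd') (perm_sumn dd'). Qed.

Lemma perm_cactus_sequence d d' : perm_eq d d' -> cactus_sequence d = cactus_sequence d'.
Proof.
move=> dd'; rewrite /cactus_sequence (perm_cactus_bound dd') (perm_mu1 dd') (perm_muodd dd').
by rewrite (perm_size dd') (perm_sumn dd') (perm_mem dd').
Qed.

Lemma perm_cons_nseq (T : eqType) k (x y : T) s : x != y -> x \in s -> k <= count_mem y s ->
  exists s', perm_eq s (x :: nseq k y ++ s').
Proof.
move=> xy xs; rewrite (permP (perm_to_rem xs)) /= (negbTE xy) add0n => ky.
exists (nseq (count_mem y (rem x s) - k) y ++ filter (predC1 y) (rem x s)).
rewrite catA -nseqD subnKC //.
have <- : filter (pred1 y) (rem x s) = nseq (count_mem y (rem x s)) y.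
  by rewrite -size_filter; apply/all_pred1P/filter_all.
by rewrite (permPl (perm_to_rem xs)) perm_cons perm_sym perm_filterC.
Qed.

Lemma odd_sumn d : odd (sumn d) = odd (mu1 d + muodd d).
Proof. by rewrite -count_odd; elim: d => //= x d IH; rewrite !oddD IH oddb. Qed.

Lemma sumn_excess d : 0 \notin d ->
  sumn d + mu1 d = 2 * size d + sumn [seq x - 2 | x <- d].
Proof. by rewrite /mu1; elim: d => //= x d IH; rewrite inE negb_or => /andP[x0 /IH]; lia. Qed.

Lemma has_geq3 d : 0 \notin d -> has (leq 3) d = (2 * size d < sumn d + mu1 d).
Proof.
move=> d0; rewrite sumn_excess // -[ltnLHS]addn0 ltn_add2l.
by elim: d {d0} => //= x d ->; lia.
Qed.

Lemma all_eq2 d : 0 \notin d -> mu1 d = 0 -> sumn d <= 2 * size d -> all (pred1 2) d.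
Proof.
move=> d0 no_leaf small; have := has_geq3 d0; rewrite no_leaf addn0 ltnNge small /=.
move/negbT/hasPn => no_geq3; apply/allP => x xd; have x_lt3 := no_geq3 x xd.
have x_neq0 : x != 0 by apply: contraNneq d0 => <-.
suff : x != 1 by rewrite /=; lia.
apply/eqP => x1; suff : 0 < mu1 d by rewrite no_leaf.
by rewrite -has_count; apply/hasP; exists x => //; apply/eqP.
Qed.

Lemma leq_mul3_size d : 0 \notin d -> 3 * size d <= sumn d + 2 * mu1 d + count_mem 2 d.
Proof. by rewrite /mu1; elim: d => //= x d IH; rewrite inE negb_or => /andP[x0 /IH]; lia. Qed.

Lemma cactus_sequence_mem2 d :
  cactus_sequence d -> 0 < mu1 d -> mu1 d + muodd d <= 2 -> 2 \in d.
Proof.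
case/and5P => d0 _ size_sum bound _ leaf few_odd.
apply/negPn/negP => /count_memPn no2; have := leq_mul3_size d0; rewrite {}no2.
by move: bound; rewrite /cactus_bound /beta; lia.
Qed.

Lemma beta_no_odd d : muodd d = 0 -> beta d = mu1 d.
Proof. by move=> no_odd; rewrite /beta no_odd addn0; apply/maxn_idPl; lia. Qed.

Lemma cactus_sequence_contract d :
  cactus_sequence (2 :: 1 :: d) -> ~~ tight_bound (2 :: 1 :: d) -> cactus_sequence (1 :: d).
Proof.
rewrite /cactus_sequence /cactus_bound /tight_bound -[beta (2 :: _)]/(beta (1 :: d)).
rewrite -[mu1 (2 :: _)]/(mu1 (1 :: d)) -[muodd (2 :: _)]/(muodd (1 :: d)) /= !inE /=.
case/and5P => -> even_sum size_sum bound some_odd slack /=.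
by apply/and4P; split; move: even_sum size_sum bound slack => //; lia.
Qed.

Lemma cactus_sequence_prune_odd x d : odd x ->
  tight_bound (x.+2 :: 1 :: d) || (2 < mu1 (x.+2 :: 1 :: d) + muodd (x.+2 :: 1 :: d)) ->
  cactus_sequence (x.+2 :: 1 :: d) -> cactus_sequence (x.+1 :: d).
Proof.
move=> x_odd; rewrite /cactus_sequence /cactus_bound /tight_bound.
have mu1_pruned : mu1 (x.+1 :: d) = mu1 d by case: x x_odd.
have muodd_pruned : muodd (x.+1 :: d) = muodd d by rewrite /muodd /= x_odd.
have mu1_full : mu1 (x.+2 :: 1 :: d) = (mu1 d).+1 by [].
have muodd_full : muodd (x.+2 :: 1 :: d) = (muodd d).+1 by rewrite /muodd /= x_odd.
have betaE : beta (x.+2 :: 1 :: d) = (beta (x.+1 :: d)).+1.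
  by rewrite /beta mu1_pruned muodd_pruned mu1_full muodd_full addSn addnS maxnSS.
rewrite betaE mu1_pruned muodd_pruned mu1_full muodd_full /= !inE => spare.
case/and5P => -> even_sum size_sum bound _ /=; apply/and4P; split.
- lia.
- lia.
- lia.
have [no_odd|//] := posnP (mu1 d + muodd d).
have beta0 : beta (x.+1 :: d) = 0 by rewrite /beta mu1_pruned muodd_pruned; lia.
by case/orP: spare => [/eqP|]; rewrite ?beta0; lia.
Qed.

Lemma cactus_sequence_prune_even x d : ~~ odd x -> muodd d = 0 ->
  tight_bound (x.+4 :: 1 :: 1 :: d) || (2 < mu1 (x.+4 :: 1 :: 1 :: d)) ->
  cactus_sequence (x.+4 :: 1 :: 1 :: d) -> cactus_sequence (x.+2 :: d).
Proof.
move=> x_even no_odd; rewrite /cactus_sequence /cactus_bound /tight_bound.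
have muodd_pruned : muodd (x.+2 :: d) = 0.
  by rewrite /muodd /= negbK (negbTE x_even) -/(muodd d).
have muodd_full : muodd (x.+4 :: 1 :: 1 :: d) = 0.
  by rewrite /muodd /= !negbK (negbTE x_even) -/(muodd d).
rewrite !beta_no_odd // muodd_pruned muodd_full !addn0 -[mu1 (x.+4 :: _)]/(mu1 d).+2.
rewrite -[mu1 (x.+2 :: _)]/(mu1 d) /= !inE => spare.
case/and5P => -> even_sum size_sum bound _ /=; apply/and4P; split.
- lia.
- lia.
- lia.
have [no_leaf|//] := posnP (mu1 d).
by case/orP: spare => [/eqP|]; lia.
Qed.

Lemma cactus_sequence_remove_square x d : mu1 d = 0 ->
  2 * size (x.+3 :: nseq 3 2 ++ d) < sumn (x.+3 :: nseq 3 2 ++ d) ->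
  cactus_sequence (x.+3 :: nseq 3 2 ++ d) -> cactus_sequence (x.+1 :: d).
Proof.
move=> no_leaf many_cycles.
rewrite /cactus_sequence /cactus_bound => /and5P[d0 even_sum _ bound some_odd].
have no_leaf_full : mu1 (x.+3 :: nseq 3 2 ++ d) = 0 by [].
have oddsE : mu1 (x.+1 :: d) + muodd (x.+1 :: d) = muodd (x.+3 :: nseq 3 2 ++ d).
  have := count_odd (x.+3 :: nseq 3 2 ++ d); rewrite no_leaf_full add0n => <-.
  by rewrite -count_odd /= negbK.
have few_leaves : mu1 (x.+1 :: d) <= 1 by rewrite /mu1 /= -/(mu1 d) no_leaf addn0 leq_b1.
have even_odds : ~~ odd (muodd (x.+3 :: nseq 3 2 ++ d)).
  by have := odd_sumn (x.+3 :: nseq 3 2 ++ d); rewrite no_leaf_full add0n => <-.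
have betaE : beta (x.+1 :: d) = beta (x.+3 :: nseq 3 2 ++ d).
  rewrite /beta no_leaf_full add0n max0n oddsE; apply/maxn_idPr.
  by move: few_leaves even_odds; rewrite -oddsE; case: (mu1 _) => [|[|k]] //; lia.
rewrite betaE oddsE; apply/and5P; split.
- by move: d0; rewrite /= !inE.
- by move: even_sum => /=; lia.
- by move: even_sum many_cycles => /=; lia.
- by move: bound => /=; lia.
- by move: some_odd; rewrite no_leaf_full => /orP[->//|] /=; lia.
Qed.

Definition realizable_below n : Prop :=
  forall d, size d < n -> cactus_sequence d -> realizable d.

Lemma realizable_leafless d : realizable_below (size d) ->
  cactus_sequence d -> mu1 d = 0 -> realizable d.
Proof.
move=> IH cs no_leaf; have /and5P[d0 _ size_sum bound sum4] := cs.
have size3 := leq_mul3_size d0; rewrite /cactus_bound in bound.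
have [many_cycles|one_cycle] := ltnP (2 * size d) (sumn d).
  have /hasP[[|[|[|x]]] // xd _] : has (leq 3) d by rewrite has_geq3 //; lia.
  have [|d' dd'] := @perm_cons_nseq _ 3 x.+3 2 d isT xd; first lia.
  apply: (realizable_perm (d := x.+3 :: nseq 3 2 ++ d')); first by rewrite perm_sym.
  apply/realizable_square/IH; first by rewrite (perm_size dd') /=; lia.
  apply: cactus_sequence_remove_square.
  - by move: no_leaf; rewrite (perm_mu1 dd').
  - by rewrite -(perm_size dd') -(perm_sumn dd').
  - by rewrite -(perm_cactus_sequence dd').
have dE : d = nseq (size d) 2 by apply/all_pred1P/all_eq2.
have no_odd : muodd d = 0 by rewrite dE /muodd count_nseq.
have size_gt2 : 2 < size d by lia.
have := @realizable_cycle (size d); rewrite size_gt2 -dE; apply; lia.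
Qed.

Lemma realizable_below_pendant d d' x : realizable_below (size d) ->
  perm_eq d (x.+1 :: 1 :: d') -> cactus_sequence (x :: d') -> realizable d.
Proof.
move=> IH dd' cs; apply: (realizable_perm (d := x.+1 :: 1 :: d')); first by rewrite perm_sym.
by apply/realizable_pendant/IH; rewrite // (perm_size dd').
Qed.

Lemma realizable_below_pendant2 d d' x : realizable_below (size d) ->
  perm_eq d (x.+2 :: 1 :: 1 :: d') -> cactus_sequence (x :: d') -> realizable d.
Proof.
move=> IH dd' cs; apply: (realizable_perm (d := x.+2 :: 1 :: 1 :: d')).
  by rewrite perm_sym.
apply/realizable_pendant/(realizable_perm (d := x.+1 :: 1 :: d')) => //.
by apply/realizable_pendant/IH; rewrite // (perm_size dd') /=; lia.
Qed.

Lemma realizable_with_leaf d : realizable_below (size d) ->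
  cactus_sequence d -> 0 < mu1 d -> realizable d.
Proof.
move=> IH cs leaf; have /and5P[d0 even_sum size_sum _ _] := cs.
have [/andP[in2 slack]|spare] := boolP ((2 \in d) && ~~ tight_bound d).
  have [//|d' dd'] := @perm_cons_nseq _ 1 2 1 d isT in2.
  apply: (realizable_below_pendant IH dd'); apply: cactus_sequence_contract.
  - by rewrite -(perm_cactus_sequence dd').
  - by rewrite -(perm_tight_bound dd').
have {}spare : tight_bound d || (2 < mu1 d + muodd d).
  rewrite negb_and negbK in spare; case/orP: spare => [no2|->//].
  by apply: contraNT no2; rewrite negb_or -leqNgt => /andP[_]; apply: cactus_sequence_mem2.
have [no_odd|some_odd] := posnP (muodd d).
  have /hasP[x xd x3] : has (leq 3) d by rewrite has_geq3 //; lia.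
  have x_even : ~~ odd x.
    apply/negP => x_odd; suff : 0 < muodd d by rewrite no_odd.
    by rewrite -has_count; apply/hasP; exists x; rewrite // x_odd ltnW.
  case: x xd x3 x_even => [|[|[|[|x]]]] //= xd _; rewrite !negbK => x_even.
  have [|d' dd'] := @perm_cons_nseq _ 2 x.+4 1 d isT xd.
    by have := odd_sumn d; rewrite -/(mu1 d); lia.
  apply: (realizable_below_pendant2 IH dd'); apply: cactus_sequence_prune_even => //.
  - by move: no_odd; rewrite (perm_muodd dd') /muodd /= !negbK (negbTE x_even).
  - by move: spare; rewrite (perm_tight_bound dd') no_odd addn0 (perm_mu1 dd').
  - by rewrite -(perm_cactus_sequence dd').
have /hasP[[|[|x]] // xd /andP[/= x_odd _]] : has (fun x => odd x && (1 < x)) d.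
  by rewrite has_count.
rewrite negbK in x_odd.
have [//|d' dd'] := @perm_cons_nseq _ 1 x.+2 1 d isT xd.
apply: (realizable_below_pendant IH dd'); apply: cactus_sequence_prune_odd => //.
- by rewrite -(perm_tight_bound dd') -(perm_mu1 dd') -(perm_muodd dd').
- by rewrite -(perm_cactus_sequence dd').
Qed.

Lemma cactus_sequence_realizable d : cactus_sequence d -> realizable d.
Proof.
have [n] := ubnP (size d); elim: n d => // n IH d size_d cs.
have below : realizable_below (size d) by move=> d' lt_d'; apply: IH; lia.
by have [/realizable_leafless|/realizable_with_leaf] := posnP (mu1 d); apply.
Qed.

End Reduction.

(** * Realizations on ['I_n] *)

Section Isomorphism.
Variables (T U : finType) (f : U -> T) (e : rel T).
Hypothesis f_bij : bijective f.

Lemma degree_relpre x : degree (relpre f e) x = degree e (f x).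
Proof.
rewrite /degree -(on_card_preimset (onW_bij _ f_bij)); congr #|pred_of_set _|.
by apply/setP => y; rewrite !inE.
Qed.

Lemma bipartite_cactus_relpre : bipartite_cactus e -> bipartite_cactus (relpre f e).
Proof.
move=> [ie se con de [c col]]; have [g fK gK] := f_bij; split.
- by move=> x /=.
- by move=> x y /=.
- move=> x y; rewrite -[x]fK -[y]fK; apply: connect_homo (con (f x) (f y)) => u v.
  by rewrite /= !gK.
- exact: edge_disjoint_cycles_preim (bij_inj f_bij) _ de.
- by exists (c \o f) => x y; apply: col.
Qed.

End Isomorphism.

Lemma bipartite_cactusP n (e : rel 'I_n) :
  bipartite_cactus e <-> simple_graph e /\ bi_cactus e.
Proof.
split=> [[ie se con de col]|[[ie se] [[con de] col]]].
  split; first by split=> // x; rewrite ie.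
  split=> //; split=> // s1 s2 /and3P c1 /and3P c2; exact: de.
split=> // [x|s1 s2 /and3P c1 /and3P c2]; first exact/negbTE.
exact: de.
Qed.

Lemma realizable_ord n d : size d = n ->
  realizable d <-> exists e : rel 'I_n, realizes e d /\ bi_cactus e.
Proof.
move=> size_d; split=> [[T [e [cac /perm_map_lift[s s_enum degE]]]]|[e [[simple degE] bic]]].
  have size_s : size s == n by rewrite -size_d -degE size_map.
  pose f := tnth (Tuple size_s).
  have f_bij : bijective f.
    apply: inj_card_bij; last by rewrite card_ord -(eqP size_s) (perm_size s_enum) -cardE.
    by apply/tuple_uniqP; rewrite /= (perm_uniq s_enum) enum_uniq.
  have /bipartite_cactusP[simple bic] := bipartite_cactus_relpre f_bij cac.
  exists (relpre f e); split=> //; split=> // i; rewrite [LHS](degree_relpre e f_bij).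
  by rewrite -degE (nth_map (f i)) ?(eqP size_s) // -(tnth_nth (f i) (Tuple size_s)).
exists 'I_n, e; split; first exact/bipartite_cactusP.
suff -> : codom (degree e) = d by [].
apply: (@eq_from_nth _ 0) => [|i]; rewrite size_codom card_ord ?size_d // => lt_in.
rewrite (nth_map (Ordinal lt_in)) ?size_enum_ord // -[LHS]/(deg e _) degE.
by rewrite nth_enum_ord.
Qed.

Lemma realizable_cactus_bound d : 2 < size d -> realizable d -> cactus_bound d.
Proof.
move=> size_d [T [e [cac degE]]]; rewrite -(perm_cactus_bound degE).
by apply: bipartite_cactus_bound cac; rewrite -(size_codom (degree e)) (perm_size degE).
Qed.

Theorem theorem7p3 (n : nat) (d : seq nat) :
  degree_sequence n d ->
  2 <= nth 0 d 3 ->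
  2 * n < sumn d ->
  2 <= muodd d + mu1 d ->
  (exists e : rel 'I_n, realizes e d /\ bi_cactus e) <->
  (sumn d)./2 <= (4 * (n - 1) - beta d) %/ 3.
Proof.
case=> size_d degrees even_sum _ d4 sum_gt some_odd.
have n_gt3 : 3 < n by rewrite -size_d ltnNge; apply/negP => le3; rewrite nth_default in d4.
have -> : ((sumn d)./2 <= (4 * (n - 1) - beta d) %/ 3) = cactus_bound d.
  by rewrite leq_divRL // /cactus_bound size_d; lia.
rewrite -(realizable_ord size_d); split=> [|bound].
  by apply: realizable_cactus_bound; rewrite size_d ltnW.
apply: cactus_sequence_realizable; apply/and5P; split=> //.
- by apply/negP => /(allP degrees).
- by rewrite size_d ltnW.
- by rewrite addnC ltnW.
Qed.
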